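(* Let $\{d_1,\ldots,d_n\}$ be a finite subset of the Cantor set $\{0,1\}^\omega$, and let $\mathrm{Stab}_F(d_1,\ldots,d_n)$ be the subgroup of Thompson's group $F$ consisting of the elements fixing each of $d_1,\ldots,d_n$ under the standard action. Then the Schreier graph $\Gamma(F,\mathrm{Stab}_F(d_1,\ldots,d_n),\{x_0,x_1\})$ is amenable.
   Context: Thompson's group $F$ is the group of all strictly increasing piecewise linear homeomorphisms of $[0,1]$ that are differentiable except at finitely many dyadic rationals and whose slopes are integer powers of $2$; products are read left to right, $(fg)(x)=g(f(x))$. It is generated by $x_0,x_1$, where $x_0(t)=t/2$ on $[0,\frac12]$, $t-\frac14$ on $[\frac12,\frac34]$, $2t-1$ on $[\frac34,1]$; and $x_1(t)=t$ on $[0,\frac12]$, $\frac t2+\frac14$ on $[\frac12,\frac34]$, $t-\frac18$ on $[\frac34,\frac78]$, $2t-1$ on $[\frac78,1]$. The standard action of $F$ on the Cantor set $\{0,1\}^\omega$ is induced by binary expansions and is given by $x_0: 0u\mapsto 00u,\ 10u\mapsto 01u,\ 11u\mapsto 1u$; $x_1: 0u\mapsto 0u,\ 10u\mapsto 100u,\ 110u\mapsto 101u,\ 111u\mapsto 11u$. For a subgroup $H\le F$, the Schreier graph $\Gamma(F,H,\{x_0,x_1\})$ has the right cosets $Hg$, $g\in F$, as vertices, with an edge labeled $s$ from $Hg$ to $Hgs$ for each $s\in\{x_0,x_1\}$. A graph of bounded degree is amenable if the infimum of $|\partial A|/|A|$ over nonempty finite sets $A$ of vertices is $0$, where $\partial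 A$ is the set of edges joining $A$ to its complement. *)

(* Defs.v *)
From HB Require Import structures.
From mathcomp Require Import all_boot all_order all_algebra.
From mathcomp Require Import all_classical all_reals all_analysis.
From mathcomp Require Import finmap zify ring lra.

Set Implicit Arguments.
Unset Strict Implicit.
Unset Printing Implicit Defensive.

Import Order.TTheory GRing.Theory Num.Theory.
Import numFieldNormedType.Exports.

Local Open Scope classical_set_scope.
Local Open Scope ring_scope.

Definition dyadic (R : realType) : set R :=
  [set x | exists (m : int) (n : nat), x = m%:~R / 2 ^+ n].

(* [f] is affine, with slope an integer power of 2, on each subinterval of
   [0, 1] whose interior avoids the finitely many dyadic breakpoints in [s]. *)
Definition dyadic_pl (R : realType) (f : R -> R) : Prop :=
  exists s : seq R, (forall c, c \in s -> dyadic c) /\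
    forall a b : R, 0 <= a -> a < b -> b <= 1 ->
      (forall c, c \in s -> ~~ (a < c < b)) ->
      exists k : int, forall x : R, a <= x <= b -> f x = f a + 2 ^ k * (x - a).

(* A self-map of [0, 1] is represented by its extension by the identity to the
   whole line, so that equality of elements of F is equality of functions. The
   inverse of a continuous bijection of [0, 1] is automatically continuous. *)
Definition in_thompsonF (R : realType) (f : R -> R) : Prop :=
  [/\ set_bij `[0, 1] `[0, 1] f,
      {within `[0, 1], continuous f},
      {in `[0, 1] &, {homo f : x y / x < y}},
      dyadic_pl f &
      forall x : R, x \notin `[0, 1] -> f x = x].

Record thompsonF (R : realType) : Type := ThompsonF {
  thompsonF_fun :> R -> R;
  thompsonF_fun_in : in_thompsonF thompsonF_fun }.

HB.instance Definition _ (R : realType) := gen_eqMixin (thompsonF R).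
HB.instance Definition _ (R : realType) := gen_choiceMixin (thompsonF R).

Lemma thompsonF_eq (R : realType) (f g : thompsonF R) : f =1 g -> f = g.
Proof.
case: f g => [f fF] [g gF] /= /funext fg; rewrite -fg in gF *.
by congr ThompsonF; exact: Prop_irrelevance.
Qed.

Lemma in_thompsonFP (R : realType) (f : R -> R) :
  in_thompsonF f <->
  [/\ {mono f : x y / x < y}, (forall y, exists x, f x = y),
      (forall x : R, ~~ (0 <= x <= 1) -> f x = x) & dyadic_pl f].
Proof.
split.
- case=> -[ff fi fs] _ fm fp fo.
  have fo' x : ~~ (0 <= x <= 1) -> f x = x by move=> x01; apply: fo; rewrite in_itv.
  have ff' x : 0 <= x <= 1 -> 0 <= f x <= 1.
    by move=> x01; have := ff x; rewrite /= !in_itv /=; apply.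
  have fm' x y : 0 <= x <= 1 -> 0 <= y <= 1 -> x < y -> f x < f y.
    by move=> x01 y01; apply: fm; rewrite in_itv.
  split => //.
  + apply: leW_mono; apply: le_mono => x y xy.
    have [x01|x01] := boolP (0 <= x <= 1); have [y01|y01] := boolP (0 <= y <= 1).
    * exact: fm'.
    * by rewrite (fo' y)//; have := ff' x x01; lra.
    * by rewrite (fo' x)//; have := ff' y y01; lra.
    * by rewrite !fo'.
  + move=> y; have [y01|y01] := boolP (0 <= y <= 1); last by exists y; rewrite fo'.
    by have [|x _ <-] := fs y; [rewrite /= in_itv|exists x].
- case=> fm fs fo fp.
  have fle : {mono f : x y / x <= y}.
    by move=> x y; rewrite !leNgt fm.
  have fi : injective f by exact: inc_inj.
  have f01 (x : R) : 0 <= x <= 1 -> 0 <= f x <= 1.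
    by apply: contraTT => fx01; have /fi fxx := fo (f x) fx01; rewrite -fxx.
  have ss : set_surj `[0, 1] `[0, 1] f.
    move=> y /=; rewrite in_itv /= => y01; have [x fx] := fs y.
    exists x => //=; rewrite in_itv /=; apply/negPn/negP => nx01.
    by move: (nx01); rewrite -(fo x)// fx y01.
  have f0 : f 0 = 0.
    have [|x] := ss 0; first by rewrite /= in_itv /=; lra.
    rewrite /= in_itv /= => /andP[x0 _] fx; apply: le_anti.
    apply/andP; split; first by rewrite -[leRHS]fx fle.
    by have /andP[] : 0 <= f 0 <= 1 by apply: f01; lra.
  have f1 : f 1 = 1.
    have [|x] := ss 1; first by rewrite /= in_itv /=; lra.
    rewrite /= in_itv /= => /andP[_ x1] fx; apply: le_anti.
    apply/andP; split; last by rewrite -[leLHS]fx fle.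
    by have /andP[] : 0 <= f 1 <= 1 by apply: f01; lra.
  split => //.
  + by split => // x y _ _; exact: fi.
  + apply: segment_inc_surj_continuous; first by move=> x y _ _; exact: fle.
    by rewrite f0 f1.
  + by move=> x y _ _ xy; rewrite fm.
Qed.

Section ThompsonTheory.
Context {R : realType}.
Implicit Types (f g h : thompsonF R) (x y a b : R).

Lemma thompsonF_lt f : {mono f : x y / x < y}.
Proof. by have [] := (in_thompsonFP f).1 (thompsonF_fun_in f). Qed.

Lemma thompsonF_le f : {mono f : x y / x <= y}.
Proof. by move=> x y; rewrite !leNgt thompsonF_lt. Qed.

Lemma thompsonF_inj f : injective f.
Proof. exact/inc_inj/thompsonF_le. Qed.

Lemma thompsonF_surj f y : exists x, f x = y.
Proof. by have [_] := (in_thompsonFP f).1 (thompsonF_fun_in f). Qed.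

Lemma thompsonF_out f x : ~~ (0 <= x <= 1) -> f x = x.
Proof. by have [_ _ + _] := (in_thompsonFP f).1 (thompsonF_fun_in f); apply. Qed.

Lemma thompsonF_pl f : dyadic_pl f.
Proof. by have [_ _ _] := (in_thompsonFP f).1 (thompsonF_fun_in f). Qed.

Lemma thompsonF_itv f x : (0 <= f x <= 1) = (0 <= x <= 1).
Proof.
have [x01|x01] := boolP (0 <= x <= 1); last by rewrite thompsonF_out// (negbTE x01).
apply/negPn/negP => fx01; have := thompsonF_out f fx01 => /thompsonF_inj e.
by move: fx01; rewrite e x01.
Qed.

Lemma thompsonF0 f : f 0 = 0.
Proof.
have [x fx] := thompsonF_surj f 0; have : 0 <= x <= 1.
  by rewrite -(thompsonF_itv f) fx; lra.
move=> /andP[x0 _]; apply/le_anti/andP; split.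
  by rewrite -[leRHS]fx thompsonF_le.
by have /andP[] : 0 <= f 0 <= 1 by rewrite thompsonF_itv; lra.
Qed.

Lemma thompsonF1 f : f 1 = 1.
Proof.
have [x fx] := thompsonF_surj f 1; have : 0 <= x <= 1.
  by rewrite -(thompsonF_itv f) fx; lra.
move=> /andP[_ x1]; apply/le_anti/andP; split; last by rewrite -[leLHS]fx thompsonF_le.
by have /andP[] : 0 <= f 1 <= 1 by rewrite thompsonF_itv; lra.
Qed.

Lemma dyadic0 : dyadic (0 : R).
Proof. by exists 0, 0; rewrite mul0r. Qed.

Lemma dyadicD x y : dyadic x -> dyadic y -> dyadic (x + y).
Proof.
move=> [m [p ->]] [n [q ->]]; exists (m * 2 ^+ q + n * 2 ^+ p), (p + q)%N.
rewrite rmorphD !rmorphM !rmorphXn /= exprD.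
by field; rewrite !expf_neq0//; lra.
Qed.

Lemma dyadicN x : dyadic x -> dyadic (- x).
Proof. by move=> [m [p ->]]; exists (- m), p; rewrite rmorphN mulNr. Qed.

Lemma dyadicB x y : dyadic x -> dyadic y -> dyadic (x - y).
Proof. by move=> dx dy; apply/dyadicD/dyadicN. Qed.

Lemma dyadicZ (k : int) x : dyadic x -> dyadic (2 ^ k * x).
Proof.
move=> [m [p ->]]; case: k => k.
- exists (2 ^+ k * m), p.
  by rewrite rmorphM rmorphXn /= -exprnP mulrA.
- exists m, (k.+1 + p)%N.
  rewrite NegzE exprD -exprnN.
  by field; rewrite !expf_neq0//; lra.
Qed.

Lemma dyadicZ_inv (k : int) x : dyadic (2 ^ k * x) -> dyadic x.
Proof.
move=> /(dyadicZ (- k)); rewrite mulrA -expfzDr ?addNr ?expr0z ?mul1r//; lra.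
Qed.

(* Induction on the number of breakpoints between [a] and [b]. *)
Lemma thompsonF_dyadic_sub f a b : 0 <= a -> a < b -> b <= 1 -> dyadic a ->
  dyadic b <-> dyadic (f b - f a).
Proof.
have [s [sd fs]] := thompsonF_pl f.
have [n] := ubnP (count (fun c => a < c < b) s).
elim: n a b => // n IHn a b sn a0 ab b1 da.
have [/hasP[c cs /andP[ac cb]]|/hasPn ns] := boolP (has (fun c => a < c < b) s); last first.
  have [k fk] := fs a b a0 ab b1 ns; rewrite fk ?lexx ?ltW//.
  have -> : f a + 2 ^ k * (b - a) - f a = 2 ^ k * (b - a) by ring.
  split=> [db|/dyadicZ_inv dba]; first exact/dyadicZ/dyadicB.
  by rewrite -(subrK a b); exact: dyadicD.
have cn u v : a <= u -> v <= b -> ~~ (u < c < v) ->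
    (count (fun x : R => (u < x < v)%R) s < n)%N.
  move=> au vb cuv; rewrite ltnS in sn; apply: leq_trans sn.
  have /permP -> := perm_to_rem cs; have /permP -> := perm_to_rem cs.
  rewrite /= (negbTE cuv) ac cb /= add0n add1n ltnS; apply: sub_count => x /=; lra.
have dc := sd c cs.
have dca : dyadic (f c - f a).
  apply/(IHn a c) => //; last exact: le_trans (ltW cb) b1.
  by apply: cn; [exact: lexx|exact: ltW|rewrite ltxx andbF].
have -> : f b - f a = (f b - f c) + (f c - f a) by ring.
have H : dyadic b <-> dyadic (f b - f c).
  apply: IHn => //; last exact: le_trans a0 (ltW ac).
  by apply: cn; [exact: ltW|exact: lexx|rewrite ltxx].
split=> [/H db|db]; first exact: dyadicD.
apply/H; have -> : f b - f c = f b - f c + (f c - f a) - (f c - f a) by ring.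
exact: dyadicB.
Qed.

Lemma thompsonF_dyadic f x : dyadic (f x) <-> dyadic x.
Proof.
have [/andP[x0 x1]|x01] := boolP (0 <= x <= 1); last by rewrite thompsonF_out.
move: x0; rewrite le_eqVlt => /predU1P[<-|x0]; first by rewrite thompsonF0.
have := thompsonF_dyadic_sub f (lexx _) x0 x1 dyadic0.
by rewrite thompsonF0 subr0 => H; split=> /H.
Qed.

Lemma id_in_thompsonF : in_thompsonF (@id R).
Proof.
apply/in_thompsonFP; split => //; first by move=> y; exists y.
by exists [::]; split=> // a b _ _ _ _; exists 0 => x _; rewrite expr0z; ring.
Qed.

Lemma comp_in_thompsonF f g : in_thompsonF (g \o f).
Proof.
apply/in_thompsonFP; split.
- by move=> x y /=; rewrite !thompsonF_lt.
- move=> z; have [y <-] := thompsonF_surj g z.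
  by have [x <-] := thompsonF_surj f y; exists x.
- by move=> x x01 /=; rewrite (thompsonF_out f)// thompsonF_out.
- have [s [sd fs]] := thompsonF_pl f; have [t [td gt]] := thompsonF_pl g.
  pose fi y := sval (cid (thompsonF_surj f y)).
  have fiK y : f (fi y) = y by rewrite /fi; case: cid.
  exists (s ++ map fi t); split.
    move=> c; rewrite mem_cat => /orP[/sd//|/mapP[d /td dd ->]].
    by apply/(thompsonF_dyadic f); rewrite fiK.
  move=> a b a0 ab b1 st.
  have [|k fk] := fs a b a0 ab b1.
    by move=> c cs; apply: st; rewrite mem_cat cs.
  have [||||l gl] := gt (f a) (f b).
  + by rewrite -(thompsonF0 f) thompsonF_le.
  + by rewrite thompsonF_lt.
  + by rewrite -(thompsonF1 f) thompsonF_le.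
  + move=> c ct; rewrite -(fiK c) !thompsonF_lt; apply: st.
    by rewrite mem_cat map_f ?orbT.
  exists (l + k) => x x01 /=; rewrite gl ?thompsonF_le//.
  by rewrite (fk x)// expfzDr; [ring|lra].
Qed.

Definition thompsonF_inv_fun f y : R := sval (cid (thompsonF_surj f y)).

Lemma thompsonF_inv_funK f : cancel (thompsonF_inv_fun f) f.
Proof. by move=> y; rewrite /thompsonF_inv_fun; case: cid. Qed.

Lemma thompsonF_funK f : cancel f (thompsonF_inv_fun f).
Proof. by move=> x; apply: (@thompsonF_inj f); rewrite thompsonF_inv_funK. Qed.

Lemma inv_in_thompsonF f : in_thompsonF (thompsonF_inv_fun f).
Proof.
have fK := thompsonF_inv_funK f.
have lt : {mono thompsonF_inv_fun f : x y / x < y}.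
  by move=> x y; rewrite -(thompsonF_lt f) !fK.
have le : {mono thompsonF_inv_fun f : x y / x <= y}.
  by move=> x y; rewrite -(thompsonF_le f) !fK.
have i0 : thompsonF_inv_fun f 0 = 0 by rewrite -{1}(thompsonF0 f) thompsonF_funK.
have i1 : thompsonF_inv_fun f 1 = 1 by rewrite -{1}(thompsonF1 f) thompsonF_funK.
apply/in_thompsonFP; split => //.
- by move=> x; exists (f x); rewrite thompsonF_funK.
- by move=> x x01; apply: (@thompsonF_inj f); rewrite fK thompsonF_out.
- have [s [sd fs]] := thompsonF_pl f; exists (map f s); split.
    by move=> c /mapP[d /sd dd ->]; exact/thompsonF_dyadic.
  move=> a b a0 ab b1 st.
  have [||||k fk] := fs (thompsonF_inv_fun f a) (thompsonF_inv_fun f b).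
  + by rewrite -i0 le.
  + by rewrite lt.
  + by rewrite -i1 le.
  + by move=> c cs; rewrite -[_ < c](thompsonF_lt f) -[c < _](thompsonF_lt f) !fK; apply: st; rewrite map_f.
  exists (- k) => y y01; have := fk (thompsonF_inv_fun f y).
  rewrite !le !fK => /(_ y01) yE; rewrite [in RHS]yE.
  have k0 : (2 ^ k : R) != 0 by rewrite expfz_neq0//; lra.
  by rewrite -invr_expz; field.
Qed.

Definition thompsonF_one : thompsonF R := ThompsonF id_in_thompsonF.
(* Products are read from left to right. *)
Definition thompsonF_mul f g : thompsonF R := ThompsonF (comp_in_thompsonF f g).
Definition thompsonF_inv f : thompsonF R := ThompsonF (inv_in_thompsonF f).

Lemma thompsonF_mulA : associative thompsonF_mul.
Proof. by move=> f g h; exact: thompsonF_eq. Qed.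
Lemma thompsonF_mul1 : left_id thompsonF_one thompsonF_mul.
Proof. by move=> f; exact: thompsonF_eq. Qed.
Lemma thompsonF_mulr1 : right_id thompsonF_one thompsonF_mul.
Proof. by move=> f; exact: thompsonF_eq. Qed.
Lemma thompsonF_mulV : left_inverse thompsonF_one thompsonF_inv thompsonF_mul.
Proof. by move=> f; apply: thompsonF_eq => x; exact: thompsonF_inv_funK. Qed.
Lemma thompsonF_mulrV : right_inverse thompsonF_one thompsonF_inv thompsonF_mul.
Proof. by move=> f; apply: thompsonF_eq => x; exact: thompsonF_funK. Qed.

End ThompsonTheory.

HB.instance Definition _ (R : realType) := isGroup.Build (thompsonF R)
  (@thompsonF_mulA R) (@thompsonF_mul1 R) (@thompsonF_mulr1 R)
  (@thompsonF_mulV R) (@thompsonF_mulrV R).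

Definition bin_val (R : realType) (u : cantor_space) : R :=
  limn (series (fun k : nat => (u k)%:R / 2 ^+ k.+1 : R)).

Definition ends_in (b : bool) (u : cantor_space) : Prop :=
  \forall k \near \oo, u k = b.

(* [v] is the binary expansion of the image under [f] of the number with binary
   expansion [u]. A dyadic rational of ]0, 1[ has two expansions, one ending in
   0's and one ending in 1's: as [f] is increasing and preserves dyadic
   rationals, it acts on each of the two kinds of expansions. *)
Definition acts_to (R : realType) (f : R -> R) (u v : cantor_space) : Prop :=
  [/\ bin_val R v = f (bin_val R u),
      ends_in false u <-> ends_in false v &
      ends_in true u <-> ends_in true v].

(* The standard action of F, a right action. The choice operator is harmless by
   [F_act_exists] and [acts_to_inj] below. *)
Definition F_act (R : realType) (u : cantor_space) (f : thompsonF R) :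
  cantor_space := get [set v | acts_to f u v].

Definition ccons (b : bool) (u : cantor_space) : cantor_space :=
  fun k => if k is k'.+1 then u k' else b.

Section BinaryExpansion.
Context {R : realType}.
Implicit Types (u v w : cantor_space) (x y : R) (b : bool).

Local Notation val := (bin_val R).
Local Notation dig u := (fun k : nat => (u k)%:R / 2 ^+ k.+1 : R).
Local Notation tl u := ((fun k => u k.+1) : cantor_space).

Lemma series_digits_half : series (fun k : nat => 1 / 2 ^+ k.+1 : R) @ \oo --> (1 : R).
Proof.
have := @cvg_geometric_series_half R 1 0; rewrite expr0 divr1.
by under [X in series X]eq_fun do rewrite addn1 natrX.
Qed.

Lemma series_digits_le u n : series (dig u) n <= 1.
Proof.
apply: (@le_trans _ _ (series (fun k : nat => 1 / 2 ^+ k.+1 : R) n)).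
  rewrite /series /=; apply: ler_sum => k _; rewrite ler_pM2r ?invr_gt0 ?exprn_gt0//.
  by rewrite lern1 leq_b1.
have nd : nondecreasing_seq (series (fun k : nat => 1 / 2 ^+ k.+1 : R)).
  apply/nondecreasing_seqP => k; rewrite seriesSr lerDl.
  by rewrite divr_ge0// exprn_ge0.
have := nondecreasing_cvgn_le nd (cvgP _ series_digits_half) n.
by rewrite (cvg_lim _ series_digits_half).
Qed.

Lemma series_digits_ge0 u n : 0 <= series (dig u) n.
Proof. by rewrite /series /=; apply: sumr_ge0 => k _; rewrite divr_ge0// exprn_ge0. Qed.

Lemma series_digits_cvg u : cvgn (series (dig u)).
Proof.
apply: nondecreasing_is_cvgn.
  apply/nondecreasing_seqP => k; rewrite seriesSr lerDl.
  by rewrite divr_ge0// exprn_ge0.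
by exists 1 => _ [n _ <-]; exact: series_digits_le.
Qed.

Lemma bin_val_itv u : 0 <= val u <= 1.
Proof.
have c := @series_digits_cvg u.
apply/andP; split.
- by apply: limr_ge => //; apply: nearW => n; exact: series_digits_ge0.
- by apply: limr_le => //; apply: nearW => n; exact: series_digits_le.
Qed.

Lemma bin_val_cons u : val u = ((u 0%N)%:R + val (tl u)) / 2.
Proof.
rewrite [LHS]/bin_val; apply: (@cvg_lim R^o)=> //; rewrite -cvg_shiftS /=.
rewrite [X in X @ _ --> _](_ : _ =
    (fun n => ((u 0%N)%:R + series (dig (tl u)) n) / 2)); last first.
  apply/funext => n /=; rewrite seriesEnat /= big_nat_recl//= mulrDl expr1; congr (_ + _).
  rewrite mulr_suml; apply: eq_bigr => k _.
  by rewrite [in LHS]exprSr invfM mulrA.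
apply: cvgM; last exact: cvg_cst.
apply: cvgD; first exact: cvg_cst.
exact: series_digits_cvg.
Qed.

Lemma bin_val_ccons b u : val (ccons b u) = (b%:R + val u) / 2.
Proof. by rewrite bin_val_cons. Qed.

Lemma bin_val_cst b : val (fun=> b) = b%:R.
Proof. have := bin_val_cons (fun=> b); lra. Qed.

Lemma bin_val0 u n : val u = 0 -> u n = false.
Proof.
elim: n u => [|n IHn] u u0; have := bin_val_cons u; rewrite u0.
  by have := bin_val_itv (tl u); case: (u 0%N) => //=; lra.
by move=> E; apply: (IHn (tl u)); have := bin_val_itv (tl u); case: (u 0%N) E => /=; lra.
Qed.

Lemma bin_val1 u n : val u = 1 -> u n = true.
Proof.
elim: n u => [|n IHn] u u1; have := bin_val_cons u; rewrite u1.
  by have := bin_val_itv (tl u); case: (u 0%N) => //=; lra.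
by move=> E; apply: (IHn (tl u)); have := bin_val_itv (tl u); case: (u 0%N) E => /=; lra.
Qed.

Lemma bin_val_compl u : val (fun k => ~~ u k) = 1 - val u.
Proof.
rewrite [LHS]/bin_val; apply: (@cvg_lim R^o)=> //.
rewrite [X in X @ _ --> _](_ : _ =
  (fun n => series (fun k : nat => 1 / 2 ^+ k.+1 : R) n - series (dig u) n)); last first.
  apply/funext => n; rewrite /series /= -sumrB; apply: eq_bigr => k _.
  by case: (u k) => /=; ring.
by apply: cvgB; [exact: series_digits_half|exact: series_digits_cvg].
Qed.

Lemma ends_in_tl b u : ends_in b u <-> ends_in b (tl u).
Proof.
split=> -[N _ Nu].
  by exists N => // k /= Nk; apply: Nu => /=; exact: leqW.
by exists N.+1 => // -[//|k] /= Nk; exact: Nu.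
Qed.

Lemma ends_in_ccons b c u : ends_in b (ccons c u) <-> ends_in b u.
Proof. by rewrite ends_in_tl. Qed.

Lemma ends_in_compl b u : ends_in b (fun k => ~~ u k) <-> ends_in (~~ b) u.
Proof.
split=> -[N _ Nu]; exists N => // k Nk; have := Nu k Nk => /=.
  by move=> <-; rewrite negbK.
by move=> ->; rewrite negbK.
Qed.

Lemma ends_in_inj b c u : ends_in b u -> ends_in c u -> b = c.
Proof.
move=> [N _ Nu] [M _ Mu].
by rewrite -(Nu (N + M)%N) /= ?leq_addr// (Mu (N + M)%N)//= leq_addl.
Qed.

Lemma bin_val_inj u v : val u = val v ->
  (ends_in false u <-> ends_in false v) ->
  (ends_in true u <-> ends_in true v) -> u = v.
Proof.
have head u' v' : val u' = val v' -> u' 0%N = false -> v' 0%N = true ->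
    ends_in true u' /\ ends_in false v'.
  rewrite (bin_val_cons u') (bin_val_cons v') => + u0 v0; rewrite u0 v0 /= => E.
  have := bin_val_itv (tl u'); have := bin_val_itv (tl v') => A B.
  split; exists 1%N => // -[//|k] _.
    by apply: (@bin_val1 (tl u')); lra.
  by apply: (@bin_val0 (tl v')); lra.
have head0 u' v' : val u' = val v' ->
    (ends_in true u' <-> ends_in true v') -> u' 0%N = v' 0%N.
  move=> E T; case u0 : (u' 0%N); case v0 : (v' 0%N) => //.
    have [/T tu fu] := head v' u' (esym E) v0 u0.
    by have := ends_in_inj tu fu.
  have [/T tv fv] := head u' v' E u0 v0.
  by have := ends_in_inj tv fv.
move=> E F T; apply/funext => n; elim: n u v E F T => [|n IHn] u v E F T.
  exact: head0.
have uv0 := head0 u v E T.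
apply: (IHn (tl u) (tl v)); rewrite -?ends_in_tl//.
by move: E; rewrite (bin_val_cons u) (bin_val_cons v) uv0; lra.
Qed.

Lemma ends_in_dyadic b u : ends_in b u -> dyadic (val u).
Proof.
move=> [N _]; elim: N u => [|N IHN] u Nu.
  have -> : u = (fun=> b) by apply/funext => k; exact: Nu.
  by rewrite bin_val_cst; exists b%:R, 0%N; rewrite divr1; case: b {Nu}.
rewrite bin_val_cons; have -> : ((u 0%N)%:R + val (tl u)) / 2 =
    2 ^ (-1) * ((u 0%N)%:R + val (tl u)) by rewrite mulrC.
apply/dyadicZ/dyadicD.
  by exists (u 0%N)%:R, 0%N; rewrite divr1; case: (u 0%N).
by apply: IHN => k /= Nk; exact: Nu.
Qed.

Lemma dyadic_ends_in u : dyadic (val u) -> ends_in false u \/ ends_in true u.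
Proof.
move=> [m [n]]; elim: n u m => [|n IHn] u m.
  rewrite divr1 => um; have := bin_val_itv u.
  rewrite um ler0z lerz1 => m01.
  have [m0|m1] : m = 0 \/ m = 1 by lia.
    by left; exists 0%N => // k _; apply: bin_val0; rewrite um m0.
  by right; exists 0%N => // k _; apply: bin_val1; rewrite um m1.
move=> um; have [] := IHn (tl u) (m - (u 0%N)%:R * 2 ^+ n).
- have n0 : (2 ^+ n : R) != 0 by rewrite expf_neq0//; lra.
  have := bin_val_cons u; rewrite um exprS => E.
  rewrite rmorphB rmorphM rmorphXn /= rmorph_nat mulrBl mulfK//.
  have -> : m%:~R / 2 ^+ n = 2 * (m%:~R / (2 * 2 ^+ n)) :> R by field.
  by rewrite E; lra.
- by rewrite -ends_in_tl; left.
- by rewrite -ends_in_tl; right.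
Qed.

Let T x : R := if x < 1 / 2 then 2 * x else 2 * x - 1.

Let expansion x : cantor_space := fun k => 1 / 2 <= iter k T x.

Let iterT_itv x k : 0 <= x < 1 -> 0 <= iter k T x < 1.
Proof.
move=> x01; elim: k => //= k; set t := iter k T x.
by rewrite /T; case: (ltP t (1 / 2)); lra.
Qed.

Let expansionE x n : x = series (dig (expansion x)) n + iter n T x / 2 ^+ n.
Proof.
elim: n => [|n IHn]; first by rewrite seriesEnat /= big_geq// add0r divr1.
rewrite {1}IHn seriesSr -addrA; congr (_ + _).
rewrite /expansion /=; set t := iter n T x; rewrite /T exprS.
have n0 : (2 ^+ n : R) != 0 by rewrite expf_neq0//; lra.
by case: ltP => /= _; field.
Qed.

Let bin_val_expansion x : 0 <= x < 1 -> val (expansion x) = x.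
Proof.
move=> x01; rewrite [LHS]/bin_val; apply: (@cvg_lim R^o)=> //.
have -> : series (dig (expansion x)) = (fun n => x - iter n T x / 2 ^+ n).
  by apply/funext => n; rewrite {2}(expansionE x n); ring.
rewrite -[X in _ --> X]subr0; apply: cvgB; first exact: cvg_cst.
apply: (@squeeze_cvgr _ _ _ _ (fun=> 0) (fun n => (1 / 2) ^+ n)).
- apply: nearW => n; have /andP[t0 t1] := iterT_itv n x01.
  rewrite divr_ge0 ?exprn_ge0//= expr_div_n expr1n ler_pM2r ?invr_gt0 ?exprn_gt0//.
  exact: ltW.
- exact: cvg_cst.
- by apply: cvg_expr; rewrite ger0_norm; lra.
Qed.

Let expansion_dyadic x : 0 <= x < 1 -> dyadic x -> ends_in false (expansion x).
Proof.
move=> x01 [m [n xE]].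
have iterE k : exists l : int, iter k T x = 2 ^+ k * x - l%:~R.
  elim: k => [|k [l IHk]]; first by exists 0; rewrite /= expr0; ring.
  rewrite /= /T IHk; case: ifPn => _.
    by exists (2 * l); rewrite rmorphM /= exprS; ring.
  by exists (2 * l + 1); rewrite rmorphD rmorphM /= exprS; ring.
have iter0 : iter n T x = 0.
  have := iterT_itv n x01; have [l ->] := iterE n.
  have -> : 2 ^+ n * x = m%:~R.
    by rewrite xE mulrC divfK// expf_neq0//; lra.
  rewrite -rmorphB /= ler0z ltrz1 => ml; have -> : m - l = 0 by lia.
  by [].
exists n => // k /= /subnK <-; rewrite /expansion iterD iter0.
have -> : iter (k - n) T 0 = 0.
  by elim: (k - n)%N => //= j ->; rewrite /T; case: ifPn; lra.
by apply/negbTE; lra.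
Qed.

Lemma acts_to_inj (f : R -> R) u v w : acts_to f u v -> acts_to f u w -> v = w.
Proof.
move=> [vE vF vT] [wE wF wT]; apply: bin_val_inj; first by rewrite vE.
- by rewrite -vF.
- by rewrite -vT.
Qed.

Lemma F_act_exists (f : thompsonF R) u : exists v, acts_to f u v.
Proof.
have x01 := bin_val_itv u; have := x01; rewrite -(thompsonF_itv f) => y01.
have uT b : ends_in b u -> ~ ends_in (~~ b) u.
  by move=> h1 h2; have := ends_in_inj h1 h2; case: b {h1 h2}.
have y1 : ~ ends_in true u -> 0 <= f (val u) < 1.
  move=> u1; have [/andP[-> /=]] := y01; rewrite le_eqVlt => /predU1P[|//].
  rewrite -{1}(thompsonF1 f) => /thompsonF_inj u1'.
  by exfalso; apply: u1; exists 0%N => // k _; exact: bin_val1.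
have [u0|u0] := pselect (ends_in false u).
  have u1 := uT _ u0; exists (expansion (f (val u))).
  have e0 : ends_in false (expansion (f (val u))).
    apply: expansion_dyadic; first exact: y1.
    by apply/thompsonF_dyadic; exact: ends_in_dyadic u0.
  split; first by rewrite bin_val_expansion//; exact: y1.
    by split.
  by split=> // /(ends_in_inj e0).
have [u1|u1] := pselect (ends_in true u).
  have z01 : 0 <= 1 - f (val u) < 1.
    suff : 0 < f (val u) by move: y01; lra.
    have [/andP[+ _]] := y01; rewrite le_eqVlt => /predU1P[|//].
    rewrite -{1}(thompsonF0 f) => /thompsonF_inj u1'.
    by exfalso; apply: u0; exists 0%N => // k _; exact: bin_val0.
  exists (fun k => ~~ expansion (1 - f (val u)) k).
  have e0 : ends_in true (fun k => ~~ expansion (1 - f (val u)) k).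
    apply/ends_in_compl/expansion_dyadic => //.
    apply: dyadicB; first by exists 1, 0%N; rewrite divr1.
    by apply/thompsonF_dyadic; exact: ends_in_dyadic u1.
  split; first by rewrite bin_val_compl bin_val_expansion//; ring.
    by split=> // h; have := ends_in_inj e0 h.
  by split.
have e b : ~ ends_in b (expansion (f (val u))).
  move=> /ends_in_dyadic; rewrite bin_val_expansion; last exact: y1.
  by move=> /thompsonF_dyadic/dyadic_ends_in[].
exists (expansion (f (val u))); split; first by rewrite bin_val_expansion//; exact: y1.
- by split=> // /e.
- by split=> // /e.
Qed.

Lemma F_actP (f : thompsonF R) u : acts_to f u (F_act u f).
Proof.
by have [v uv] := F_act_exists f u; exact: (@getPex _ [set v | acts_to f u v]) (ex_intro _ v uv).
Qed.

Lemma F_actE (f : thompsonF R) u v : acts_to f u v -> F_act u f = v.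
Proof. exact/acts_to_inj/F_actP. Qed.

Lemma F_act1 u : F_act u (1%g : thompsonF R) = u.
Proof. exact: F_actE. Qed.

Lemma F_actM u (f g : thompsonF R) : F_act u (f * g)%g = F_act (F_act u f) g.
Proof.
have [fE f0 f1] := F_actP f u; have [gE g0 g1] := F_actP g (F_act u f).
by apply: F_actE; split; [rewrite gE fE|rewrite f0|rewrite f1].
Qed.

End BinaryExpansion.

Definition x0_fun (R : realType) (t : R) : R :=
  if 0 <= t <= 1 / 2 then t / 2
  else if 1 / 2 <= t <= 3 / 4 then t - 1 / 4
  else if 3 / 4 <= t <= 1 then 2 * t - 1
  else t.

Definition x1_fun (R : realType) (t : R) : R :=
  if 0 <= t <= 1 / 2 then t
  else if 1 / 2 <= t <= 3 / 4 then t / 2 + 1 / 4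
  else if 3 / 4 <= t <= 7 / 8 then t - 1 / 8
  else if 7 / 8 <= t <= 1 then 2 * t - 1
  else t.

Lemma x0_funP (R : realType) (t : R) :
  [\/ (t <= 0 \/ 1 <= t) /\ x0_fun t = t,
      0 <= t <= 1 / 2 /\ x0_fun t = t / 2,
      1 / 2 <= t <= 3 / 4 /\ x0_fun t = t - 1 / 4 |
      3 / 4 <= t <= 1 /\ x0_fun t = 2 * t - 1].
Proof.
rewrite /x0_fun; case: ifPn => [?|t1]; first by apply: Or42.
case: ifPn => [?|t2]; first by apply: Or43.
case: ifPn => [?|t3]; first by apply: Or44.
by apply: Or41; split => //; have [?|?] := leP t 0; [left|right; lra].
Qed.

Lemma x1_funP (R : realType) (t : R) :
  [\/ (t <= 1 / 2 \/ 1 <= t) /\ x1_fun t = t,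
      1 / 2 <= t <= 3 / 4 /\ x1_fun t = t / 2 + 1 / 4,
      3 / 4 <= t <= 7 / 8 /\ x1_fun t = t - 1 / 8 |
      7 / 8 <= t <= 1 /\ x1_fun t = 2 * t - 1].
Proof.
rewrite /x1_fun; case: ifPn => [/andP[_ ?]|t1]; first by apply: Or41; split; [left|].
case: ifPn => [?|t2]; first by apply: Or42.
case: ifPn => [?|t3]; first by apply: Or43.
case: ifPn => [?|t4]; first by apply: Or44.
by apply: Or41; split => //; have [?|?] := leP t (1 / 2); [left|right; lra].
Qed.

Lemma x0_in_thompsonF (R : realType) : in_thompsonF (@x0_fun R).
Proof.
have lt (x y : R) : x < y -> x0_fun x < x0_fun y.
  move=> xy; have [[hx ->]|[hx ->]|[hx ->]|[hx ->]] := x0_funP x;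
  have [[hy ->]|[hy ->]|[hy ->]|[hy ->]] := x0_funP y; lra.
apply/in_thompsonFP; split.
- by apply: leW_mono; apply: le_mono => x y; exact: lt.
- move=> y.
  have [y0|y0] := leP y 0.
    by exists y; have [[hx ->]|[hx ->]|[hx ->]|[hx ->]] := x0_funP y; lra.
  have [y1|y1] := leP y (1 / 4).
    by exists (2 * y); have [[hx ->]|[hx ->]|[hx ->]|[hx ->]] := x0_funP (2 * y); lra.
  have [y2|y2] := leP y (1 / 2).
    exists (y + 1 / 4).
    by have [[hx ->]|[hx ->]|[hx ->]|[hx ->]] := x0_funP (y + 1 / 4); lra.
  have [y3|y3] := leP y 1.
    exists ((y + 1) / 2).
    by have [[hx ->]|[hx ->]|[hx ->]|[hx ->]] := x0_funP ((y + 1) / 2); lra.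
  by exists y; have [[hx ->]|[hx ->]|[hx ->]|[hx ->]] := x0_funP y; lra.
- by move=> x x01; have [[hx ->]|[hx ->]|[hx ->]|[hx ->]] := x0_funP x; lra.
- exists [:: 1 / 2; 3 / 4]; split.
    move=> c; rewrite !inE => /orP[]/eqP->.
      by exists 1, 1%N; rewrite expr1.
    by exists 3, 2%N; rewrite expr2; lra.
  move=> a b a0 ab b1 s.
  have s1 : ~~ (a < 1 / 2 < b) by apply: s; rewrite !inE eqxx.
  have s2 : ~~ (a < 3 / 4 < b) by apply: s; rewrite !inE eqxx orbT.
  have [b2|b2] := leP b (1 / 2).
    have {s s1 s2}a1 : a < 1 / 2 by lra.
    exists (-1) => x xab; rewrite exprN1.
    have fE (t : R) : 0 <= t <= 1 / 2 -> x0_fun t = t / 2.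
      by case: (x0_funP t) => -[h ->]; lra.
    rewrite (fE x) ?(fE a); lra.
  have {b2 s s1}a1 : 1 / 2 <= a by lra.
  have [b3|b3] := leP b (3 / 4).
    have {}s2 : a < 3 / 4 by lra.
    exists 0 => x xab; rewrite expr0z.
    have fE (t : R) : 1 / 2 <= t <= 3 / 4 -> x0_fun t = t - 1 / 4.
      by case: (x0_funP t) => -[h ->]; lra.
    rewrite (fE x) ?(fE a); lra.
  have {b3 a1 s2}a2 : 3 / 4 <= a by lra.
  exists 1 => x xab; rewrite expr1z.
  have fE (t : R) : 3 / 4 <= t <= 1 -> x0_fun t = 2 * t - 1.
    by case: (x0_funP t) => -[h ->]; lra.
  rewrite (fE x) ?(fE a); lra.
Qed.

Lemma x1_in_thompsonF (R : realType) : in_thompsonF (@x1_fun R).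
Proof.
have lt (x y : R) : x < y -> x1_fun x < x1_fun y.
  move=> xy; have [[hx ->]|[hx ->]|[hx ->]|[hx ->]] := x1_funP x;
  have [[hy ->]|[hy ->]|[hy ->]|[hy ->]] := x1_funP y; lra.
apply/in_thompsonFP; split.
- by apply: leW_mono; apply: le_mono => x y; exact: lt.
- move=> y.
  have [y0|y0] := leP y (1 / 2).
    by exists y; have [[hx ->]|[hx ->]|[hx ->]|[hx ->]] := x1_funP y; lra.
  have [y1|y1] := leP y (5 / 8).
    exists (2 * y - 1 / 2).
    by have [[hx ->]|[hx ->]|[hx ->]|[hx ->]] := x1_funP (2 * y - 1 / 2); lra.
  have [y2|y2] := leP y (3 / 4).
    exists (y + 1 / 8).
    by have [[hx ->]|[hx ->]|[hx ->]|[hx ->]] := x1_funP (y + 1 / 8); lra.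
  have [y3|y3] := leP y 1.
    exists ((y + 1) / 2).
    by have [[hx ->]|[hx ->]|[hx ->]|[hx ->]] := x1_funP ((y + 1) / 2); lra.
  by exists y; have [[hx ->]|[hx ->]|[hx ->]|[hx ->]] := x1_funP y; lra.
- by move=> x x01; have [[hx ->]|[hx ->]|[hx ->]|[hx ->]] := x1_funP x; lra.
- exists [:: 1 / 2; 3 / 4; 7 / 8]; split.
    move=> c; rewrite !inE => /or3P[]/eqP->.
    + by exists 1, 1%N; rewrite expr1.
    + by exists 3, 2%N; rewrite expr2; lra.
    + by exists 7, 3%N; rewrite !exprS expr0; lra.
  move=> a b a0 ab b1 s.
  have s1 : ~~ (a < 1 / 2 < b) by apply: s; rewrite !inE eqxx.
  have s2 : ~~ (a < 3 / 4 < b) by apply: s; rewrite !inE eqxx orbT.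
  have s3 : ~~ (a < 7 / 8 < b) by apply: s; rewrite !inE eqxx !orbT.
  have [b2|b2] := leP b (1 / 2).
    have {s s1 s2 s3}a1 : a < 1 / 2 by lra.
    exists 0 => x xab; rewrite expr0z.
    have fE (t : R) : 0 <= t <= 1 / 2 -> x1_fun t = t.
      by case: (x1_funP t) => -[h ->]; lra.
    rewrite (fE x) ?(fE a); lra.
  have {b2 s s1}a1 : 1 / 2 <= a by lra.
  have [b3|b3] := leP b (3 / 4).
    have {}s2 : a < 3 / 4 by lra.
    exists (-1) => x xab; rewrite exprN1.
    have fE (t : R) : 1 / 2 <= t <= 3 / 4 -> x1_fun t = t / 2 + 1 / 4.
      by case: (x1_funP t) => -[h ->]; lra.
    rewrite (fE x) ?(fE a); lra.
  have {b3 a1 s2}a2 : 3 / 4 <= a by lra.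
  have [b4|b4] := leP b (7 / 8).
    have {}s3 : a < 7 / 8 by lra.
    exists 0 => x xab; rewrite expr0z.
    have fE (t : R) : 3 / 4 <= t <= 7 / 8 -> x1_fun t = t - 1 / 8.
      by case: (x1_funP t) => -[h ->]; lra.
    rewrite (fE x) ?(fE a); lra.
  have {b4 a2 s3}a3 : 7 / 8 <= a by lra.
  exists 1 => x xab; rewrite expr1z.
  have fE (t : R) : 7 / 8 <= t <= 1 -> x1_fun t = 2 * t - 1.
    by case: (x1_funP t) => -[h ->]; lra.
  rewrite (fE x) ?(fE a); lra.
Qed.

Definition x0 (R : realType) : thompsonF R := ThompsonF (@x0_in_thompsonF R).
Definition x1 (R : realType) : thompsonF R := ThompsonF (@x1_in_thompsonF R).

Section Generators.
Context {R : realType}.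
Implicit Types u : cantor_space.
Local Notation "b :~ u" := (ccons b u) (at level 60, right associativity).

Lemma acts_to_gen (f : R -> R) u v :
  bin_val R v = f (bin_val R u) ->
  (forall b, ends_in b u <-> ends_in b v) -> acts_to f u v.
Proof. by move=> uv e; split. Qed.

Lemma F_act_x0_0 u : F_act (false :~ u) (x0 R) = false :~ false :~ u.
Proof.
apply: F_actE; apply: (@acts_to_gen (@x0_fun R)) => [|b]; last by rewrite !ends_in_ccons.
have := @bin_val_itv R u; rewrite !bin_val_ccons /=.
by set t := (X in x0_fun X); case: (x0_funP t) => -[]; rewrite {}/t => h ->; lra.
Qed.

Lemma F_act_x0_10 u : F_act (true :~ false :~ u) (x0 R) = false :~ true :~ u.
Proof.
apply: F_actE; apply: (@acts_to_gen (@x0_fun R)) => [|b]; last by rewrite !ends_in_ccons.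
have := @bin_val_itv R u; rewrite !bin_val_ccons /=.
by set t := (X in x0_fun X); case: (x0_funP t) => -[]; rewrite {}/t => h ->; lra.
Qed.

Lemma F_act_x0_11 u : F_act (true :~ true :~ u) (x0 R) = true :~ u.
Proof.
apply: F_actE; apply: (@acts_to_gen (@x0_fun R)) => [|b]; last by rewrite !ends_in_ccons.
have := @bin_val_itv R u; rewrite !bin_val_ccons /=.
by set t := (X in x0_fun X); case: (x0_funP t) => -[]; rewrite {}/t => h ->; lra.
Qed.

Lemma F_act_x1_0 u : F_act (false :~ u) (x1 R) = false :~ u.
Proof.
apply: F_actE; apply: (@acts_to_gen (@x1_fun R)) => [|b]; last by rewrite !ends_in_ccons.
have := @bin_val_itv R u; rewrite !bin_val_ccons /=.
by set t := (X in x1_fun X); case: (x1_funP t) => -[]; rewrite {}/t => h ->; lra.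
Qed.

Lemma F_act_x1_10 u :
  F_act (true :~ false :~ u) (x1 R) = true :~ false :~ false :~ u.
Proof.
apply: F_actE; apply: (@acts_to_gen (@x1_fun R)) => [|b]; last by rewrite !ends_in_ccons.
have := @bin_val_itv R u; rewrite !bin_val_ccons /=.
by set t := (X in x1_fun X); case: (x1_funP t) => -[]; rewrite {}/t => h ->; lra.
Qed.

Lemma F_act_x1_110 u :
  F_act (true :~ true :~ false :~ u) (x1 R) = true :~ false :~ true :~ u.
Proof.
apply: F_actE; apply: (@acts_to_gen (@x1_fun R)) => [|b]; last by rewrite !ends_in_ccons.
have := @bin_val_itv R u; rewrite !bin_val_ccons /=.
by set t := (X in x1_fun X); case: (x1_funP t) => -[]; rewrite {}/t => h ->; lra.
Qed.

Lemma F_act_x1_111 u :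
  F_act (true :~ true :~ true :~ u) (x1 R) = true :~ true :~ u.
Proof.
apply: F_actE; apply: (@acts_to_gen (@x1_fun R)) => [|b]; last by rewrite !ends_in_ccons.
have := @bin_val_itv R u; rewrite !bin_val_ccons /=.
by set t := (X in x1_fun X); case: (x1_funP t) => -[]; rewrite {}/t => h ->; lra.
Qed.

End Generators.

Definition F_stab (R : realType) (D : set cantor_space) : set (thompsonF R) :=
  [set g | forall d, D d -> F_act d g = d].

Lemma F_stab1 (R : realType) (D : set cantor_space) : @F_stab R D 1%g.
Proof. by move=> d _; exact: F_act1. Qed.

Lemma F_stabM (R : realType) (D : set cantor_space) (f g : thompsonF R) :
  F_stab D f -> F_stab D g -> F_stab D (f * g)%g.
Proof. by move=> fD gD d Dd; rewrite F_actM fD// gD. Qed.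

Lemma F_stabV (R : realType) (D : set cantor_space) (f : thompsonF R) :
  F_stab D f -> F_stab D f^-1%g.
Proof. by move=> fD d Dd; rewrite -{1}(fD d Dd) -F_actM mulgV F_act1. Qed.

Record digraph : Type := Digraph {
  vertex_type : choiceType;
  edge_type : choiceType;
  vertices : set vertex_type;
  edges : set edge_type;
  source : edge_type -> vertex_type;
  target : edge_type -> vertex_type }.

Arguments vertices : clear implicits.
Arguments edges : clear implicits.

Definition rcoset (G : groupType) (H : set G) (g : G) : set G :=
  [set (h * g)%g | h in H].

(* The edge labeled [s] from [H g] is the pair [(H g, s)]; its target is
   [(H g) s = H (g s)]. *)
Definition schreier_graph (G : groupType) (H S : set G) : digraph :=
  {| vertices := range (rcoset H);
     edges := range (rcoset H) `*` S;
     source := fun e => e.1;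
     target := fun e => rcoset e.1 e.2 |}.

Definition bounded_degree (X : digraph) : Prop :=
  exists n : nat, forall v, vertices X v ->
    ([set e | edges X e /\ (source e = v \/ target e = v)] #<= `I_n)%card.

Definition edge_boundary (X : digraph) (A : set (vertex_type X)) :
  set (edge_type X) :=
  [set e | edges X e /\ ~ (A (source e) <-> A (target e))].

(* Bounded degree is part of the definition, so that the boundary of a finite
   set is finite and [fset_set] counts its edges. *)
Definition amenable (R : realType) (X : digraph) : Prop :=
  bounded_degree X /\
  ereal_inf [set ((#|` fset_set (edge_boundary A)|%:R / #|` fset_set A|%:R) : R)%:E
    | A in [set A : set (vertex_type X) |
             [/\ finite_set A, A !=set0 & A `<=` vertices X]]] = 0%E.

Lemma rcosetM (G : groupType) (H : set G) (g s : G) :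
  rcoset (rcoset H g) s = rcoset H (g * s)%g.
Proof.
by rewrite /rcoset image_comp; apply: eq_imagel => h _ /=; rewrite mulgA.
Qed.

(* Main.v *)
Require Import Defs.
From mathcomp Require Import all_boot all_order all_algebra.
From mathcomp Require Import all_classical all_reals all_analysis.
From mathcomp Require Import finmap lra.

Set Implicit Arguments.
Unset Strict Implicit.
Unset Printing Implicit Defensive.

Import Order.TTheory GRing.Theory Num.Theory.

Local Open Scope classical_set_scope.
Local Open Scope ring_scope.

(** Two elements f and g of F define the same coset of Stab(D) exactly when they
    send the value of each d in D to the same real number
    ([rcoset_F_stab]): the Schreier graph is the orbital graph of the tuple of
    these values. The generators x0 and x1 agree at 0 and on [7/8, 1]
    ([x1_eq_x0]), and the powers of the inverse of x0 push every positive number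
    into [7/8, 1] ([x0V_near1]) while fixing 0. As D is finite, there is an N
    such that x0^-k moves the whole tuple into the region where x0 and x1 agree
    as soon as k >= N. From there on, the vertices v_k = Stab(D) x0^-(N + k) form
    a ray on which both labels lead from v_{k+1} to v_k.

    If some d has a value strictly between 0 and 1, the v_k are pairwise
    distinct, because x0^-1 moves every point of ]0, 1[ to the right
    ([x0V_inj]). The graph meets the segment {v_0, ..., v_(m-1)} only through the
    edges issued from v_0 and from v_m, hence through at most 4 edges, and
    letting m grow gives amenability ([amenable_ray]). Otherwise D consists of
    constant sequences, Stab(D) is all of F, and the graph has a single vertex
    and an empty boundary. *)

(** * Amenability of Schreier graphs *)

Lemma card_fset_set_le_size (T : choiceType) (X : set T) (s : seq T) :
  X `<=` [set` s] -> (#|` fset_set X| <= size s)%N.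
Proof.
move=> Xs; have fX : finite_set X by exact: sub_finite_set Xs (finite_seq s).
apply: leq_trans (size_undup s); rewrite -(size_seq_fset tt).
apply/fsubset_leq_card/fsubsetP => x; rewrite in_fset_set// seq_fsetE => /set_mem.
exact: Xs.
Qed.

(** Asking for a ratio at most 1 / n with n ranging over the naturals avoids
    divisions and extended reals when a Foelner sequence is exhibited. *)
Lemma amenable_of_boundary (R : realType) (X : digraph) :
  bounded_degree X ->
  (forall n : nat, exists A : set (vertex_type X),
    [/\ finite_set A, A !=set0, A `<=` vertices X &
        (n * #|` fset_set (edge_boundary A)| <= #|` fset_set A|)%N]) ->
  amenable R X.
Proof.
move=> bX folner; split=> //; apply/le_anti/andP; split; last first.
  by apply/le_ereal_inf_tmp => _ [A _ <-]; rewrite lee_fin divr_ge0.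
apply/lee_addgt0Pr => e e0; rewrite add0e; apply: ge_ereal_inf.
have [n _ ne] := near_infty_natSinv_lt (PosNum e0).
have [A [fA A0 AX nA]] := folner n.+1.
exists ((#|` fset_set (edge_boundary A)|%:R / #|` fset_set A|%:R) : R)%:E.
  by exists A.
have cA : (0 < #|` fset_set A|)%N.
  have [x Ax] := A0; rewrite cardfs_gt0; apply/fset0Pn; exists x.
  by rewrite in_fset_set// mem_set.
rewrite lee_fin ler_pdivrMr ?ltr0n//.
have /ltW /= en := ne n (leqnn n).
apply: le_trans (ler_wpM2r _ en) => //.
by rewrite mulrC ler_pdivlMr ?ltr0n// mulrC -natrM ler_nat.
Qed.

Lemma rcosetK (G : groupType) (C : set G) (s : G) :
  rcoset (rcoset C s) s^-1%g = C.
Proof. by rewrite rcosetM mulgV /rcoset; under eq_fun do rewrite mulg1; rewrite image_id. Qed.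

(** Right multiplication by a group element permutes the subsets of the group,
    so that a vertex has one outgoing and one incoming edge for each label. *)
Lemma bounded_degree_schreier (G : groupType) (H S : set G) :
  finite_set S -> bounded_degree (schreier_graph H S).
Proof.
move=> /finite_seqP[s ->].
(* Only the length of this list matters, hence the arbitrary source [H]. *)
exists (size [seq (H, t) | t <- s ++ s]) => C _.
pose e := [seq (C, t) | t <- s] ++ [seq (rcoset C t^-1%g, t) | t <- s].
set E := (X in (X #<= _)%card).
have Ee : E `<=` [set` e].
  move=> [C' t] [[_ /= ts] Ct]; rewrite mem_cat; apply/orP.
  case: Ct => /= [->|<-]; [left|right; rewrite -{1}(rcosetK C' t)]; exact: (map_f _ ts).
have fE : finite_set E by exact: sub_finite_set Ee (finite_seq e).
have [m Em] := fE; have /card_eqPle[EI _] := Em.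
apply: card_le_trans EI _; rewrite card_le_II -(card_fset_set Em).
by rewrite (leq_trans (card_fset_set_le_size Ee))// size_cat !size_map size_cat.
Qed.

(** Initial segments of the ray [v] are Foelner sets. Since every label leads
    from [v k.+1] to [v k] and acts injectively on the vertices, the only edge
    with a given label that ends at [v k] starts at [v k.+1]; hence no edge
    enters or leaves a segment of the ray except at its two extremities. *)
Lemma amenable_ray (R : realType) (G : groupType) (H S : set G) (v : nat -> set G) :
  finite_set S -> injective v -> (forall k, range (rcoset H) (v k)) ->
  (forall k s, S s -> rcoset (v k.+1) s = v k) ->
  amenable R (schreier_graph H S).
Proof.
move=> fS vI vH vS; apply: amenable_of_boundary; first exact: bounded_degree_schreier.
move=> n; have /finite_seqP[s Ss] := fS.
(* There are at most [2 * size s] boundary edges; adding 1 makes the segment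
   nonempty. *)
pose N := (n * (2 * size s)).+1; exists (v @` `I_N).
have cA : #|` fset_set (v @` `I_N)| = N.
  by apply: card_fset_set; apply: inj_card_eq => i j _ _; exact: vI.
split; first exact: finite_image.
- by exists (v 0%N); exists 0%N.
- by move=> _ [k _ <-]; exact: vH.
rewrite cA leqW// leq_mul2l; apply/orP; right.
rewrite -[2%N]/(size [:: v 0%N; v N]) -(size_allpairs pair).
apply: card_fset_set_le_size => -[C t] [[_ /= St] bd].
have ts : t \in s by move: St; rewrite Ss.
suff vC : C = v 0%N \/ C = v N.
  by rewrite !mem_cat; case: vC => ->; rewrite map_f ?orbT.
have [[[|k] kN Ck]|CA] := pselect ((v @` `I_N) C); first by left.
  case: bd; split=> _; last by exists k.+1.
  by rewrite -Ck vS//; exists k => //; exact: ltnW.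
have [[k kN Ck]|CtA] := pselect ((v @` `I_N) (rcoset C t)); last by case: bd; split.
have {}Ck : C = v k.+1.
  by rewrite -(rcosetK C t) -Ck -(vS k t St) rcosetK.
have [kN'|Nk] := ltnP k.+1 N; first by case: CA; exists k.+1.
by right; rewrite Ck; congr v; apply/eqP; rewrite eqn_leq Nk andbT.
Qed.

(** * Cosets of the stabilizer as tuples of real numbers *)

Section Stabilizer.
Context {R : realType} (D : set cantor_space).
Implicit Types (f g : thompsonF R) (t : R).

Lemma bin_val_F_act f u : bin_val R (F_act u f) = f (bin_val R u).
Proof. by have [] := F_actP f u. Qed.

(** The sequence [F_act u f] is determined by its value and by the digit, if any,
    in which [u] ends: only the former depends on [f]. *)
Lemma F_act_eq f g u : f (bin_val R u) = g (bin_val R u) -> F_act u f = F_act u g.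
Proof.
move=> fg; apply: F_actE; have [h0 h1 h2] := F_actP g u.
by split=> //; rewrite h0.
Qed.

(** Although two sequences may share a value, comparing values is enough to
    compare cosets: an element of F fixes a sequence if and only if it fixes its
    value, by [F_act_eq]. *)
Lemma rcoset_F_stab f g :
  rcoset (F_stab D) f = rcoset (F_stab D) g <->
  forall d, D d -> f (bin_val R d) = g (bin_val R d).
Proof.
split=> [fg d Dd|].
  have : rcoset (F_stab D) f f by exists 1%g; [exact: F_stab1|rewrite mul1g].
  rewrite fg => -[h hD <-] /=.
  by rewrite -[h _]bin_val_F_act hD.
have sub f' g' : (forall d, D d -> f' (bin_val R d) = g' (bin_val R d)) ->
    rcoset (F_stab D) f' `<=` rcoset (F_stab D) g'.
  move=> fg _ [h hD <-]; exists (h * (f' * g'^-1))%g; last by rewrite !mulgA mulgVK.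
  apply: F_stabM => // d Dd.
  by rewrite F_actM (F_act_eq (fg d Dd)) -F_actM mulgV F_act1.
move=> fg; apply/seteqP; split; apply: sub => // d Dd; exact/esym/fg.
Qed.

End Stabilizer.

(** * Dynamics of the generators near 1 *)

Section Dynamics.
Context {R : realType}.
Implicit Types (t : R) (k n : nat).

Lemma x0_lt t : 0 < t < 1 -> x0 R t < t.
Proof. by move=> ?; rewrite /x0/=; case: (x0_funP t) => -[? ->]; lra. Qed.

(** Both generators are doubling towards 1 on the subinterval [7/8, 1]. *)
Lemma x1_eq_x0 t : t = 0 \/ 7 / 8 <= t -> x1 R t = x0 R t.
Proof.
move=> ?; rewrite /x1/x0/=.
by case: (x0_funP t) => -[? ->]; case: (x1_funP t) => -[? ->]; lra.
Qed.

Lemma x0VE k t : x0 R ((x0 R ^- k.+1)%g t) = (x0 R ^- k)%g t.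
Proof.
have -> : (x0 R ^- k)%g = (x0 R ^- k.+1 * x0 R)%g :> thompsonF R.
  by rewrite -!expVgn expgSr mulgVK.
by [].
Qed.

Lemma x0V_inj t : 0 < t < 1 -> injective (fun k => (x0 R ^- k)%g t).
Proof.
move=> t01; apply/inc_inj/Order.NatMonotonyTheory.incnP => k.
rewrite -x0VE; apply: x0_lt.
set g := (x0 R ^- k.+1)%g; rewrite -{1}(thompsonF0 g) -{1}(thompsonF1 g).
by rewrite !thompsonF_lt.
Qed.

(** The orbit of 7/8 is 3/4, 1/2, 1/4, ...: from 1/2 on, x0 halves. *)
Lemma x0_expg n : (x0 R ^+ n.+2)%g (7 / 8) = (1 / 2) ^+ n.+1.
Proof.
elim: n => [|n IHn].
  rewrite expgS expg1 expr1 /=.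
  have -> : x0_fun (7 / 8 : R) = 3 / 4 by case: (x0_funP (7 / 8 : R)) => -[? ->]; lra.
  by case: (x0_funP (3 / 4 : R)) => -[? ->]; lra.
rewrite [in LHS]expgSr -[LHS]/(x0 R ((x0 R ^+ n.+2)%g (7 / 8))) IHn [in RHS]exprSr /=.
have : 0 <= (1 / 2 : R) ^+ n.+1 <= 1 / 2.
  rewrite exprn_ge0 ?exprS ?ler_piMr ?exprn_ile1//; lra.
by set t := _ ^+ _; case: (x0_funP t) => -[? ->]; lra.
Qed.

(** By monotonicity of x0^k, it amounts to the convergence to 0 of the orbit of
    7/8 under x0. *)
Lemma x0V_near1 t : 0 < t -> \forall k \near \oo, 7 / 8 <= (x0 R ^- k)%g t.
Proof.
move=> t0.
have [N _ tN] : \forall n \near \oo, (1 / 2) ^+ n.+1 <= t.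
  apply: filterS (near_infty_natSinv_expn_lt (PosNum t0)) => n /ltW /=.
  apply: le_trans; rewrite expr_div_n expr1n exprS.
  by rewrite ler_pM2l// lef_pV2 ?posrE ?mulr_gt0 ?exprn_gt0// ler_peMl ?exprn_ge0//; lra.
exists N.+2 => // -[//|[//|k]] /= kN.
rewrite -(thompsonF_le (x0 R ^+ k.+2)%g) x0_expg.
rewrite [leRHS](_ : _ = t); first exact: tN.
exact: thompsonF_inv_funK.
Qed.

End Dynamics.

Theorem proposition5p8 (R : realType) (D : set cantor_space)
    (finD : finite_set D) :
  amenable R (schreier_graph (@F_stab R D) [set x0 R; x1 R]).
Proof.
have fS : finite_set [set x0 R; x1 R] by exact: finite_set2.
(* Without a value in ]0, 1[, the group fixes all of D and there is a single
   coset. *)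
have [[d [Dd d01]]|triv] := pselect (exists d, D d /\ 0 < bin_val R d < 1); last first.
  have one (C : set (thompsonF R)) : range (rcoset (F_stab D)) C -> C = F_stab D.
    move=> [g _ <-].
    rewrite -[RHS](_ : rcoset (F_stab D) 1%g = _); last first.
      by rewrite -(mulgV g) -rcosetM rcosetK.
    apply/rcoset_F_stab => d Dd /=.
    have [d0|d1] : bin_val R d = 0 \/ bin_val R d = 1.
    - have nd : ~~ (0 < bin_val R d < 1) by apply/negP => d01; apply: triv; exists d.
      have := @bin_val_itv R d; lra.
    - by rewrite d0 thompsonF0.
    - by rewrite d1 thompsonF1.
  apply: amenable_of_boundary; first exact: bounded_degree_schreier.
  move=> n; exists [set F_stab D]; split=> //.
  - by exists (F_stab D).
  - by move=> _ ->; exists 1%g => //; apply: one; exists 1%g.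
  rewrite [edge_boundary _](_ : _ = set0) ?fset_set0 ?cardfs0 ?muln0//.
  apply/seteqP; split=> // -[C s] [[/= CV _]]; case.
  rewrite /= (one _ CV); split=> // _; apply: one.
  by exists s.
have : \forall k \near \oo, forall e, D e ->
    bin_val R e = 0 \/ 7 / 8 <= (x0 R ^- k)%g (bin_val R e).
  have := @filter_bigI nat _ (fset_set D) (fun e => [set k |
    bin_val R e = 0 \/ 7 / 8 <= (x0 R ^- k)%g (bin_val R e)]) \oo eventually_filter.
  rewrite fset_setK//; apply=> e _ /=.
  have [e0|e0] := eqVneq (bin_val R e) 0; first by exists 0%N => // k _; left.
  have /x0V_near1 : 0 < bin_val R e.
    by rewrite lt_neqAle eq_sym e0; have /andP[] := @bin_val_itv R e.
  by apply: filterS => k; right.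
move=> [N _ DN].
apply: (@amenable_ray _ _ _ _ (fun k => rcoset (F_stab D) (x0 R ^- (N + k))%g)) => //.
- move=> i j /rcoset_F_stab/(_ d Dd)/(x0V_inj d01).
  exact: addnI.
- move=> k s Ss; rewrite rcosetM; apply/rcoset_F_stab => e De.
  rewrite addnS -x0VE -[LHS]/(s ((x0 R ^- (N + k).+1)%g (bin_val R e))).
  case: Ss => -> //; apply: x1_eq_x0.
  case: (DN (N + k).+1 (leqW (leq_addr _ _)) e De) => [->|]; last by right.
  by left; exact: thompsonF0.
Qed.
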